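(* Let $X$ be a graph and let $S,T\subseteq V(X)$ be nonempty. If there is subset transfer from $S$ to $T$, then the induced subgraphs of $X$ on $S$ and on $T$ are cospectral, and the induced subgraphs of $X$ on $V(X)\setminus S$ and on $V(X)\setminus T$ are cospectral.
   Context: $X$ is a finite simple graph with adjacency matrix $A$ and $U(t)=\exp(itA)$. For $S\subseteq V(X)$, $D_S$ denotes the diagonal $0/1$ matrix with $(x,x)$-entry $1$ iff $x\in S$. There is subset transfer (perfect state transfer) from $S$ to $T$ if there is a time $t$ with $U(t)\left(\frac1{|S|}D_S\right)U(-t)=\frac1{|T|}D_T$. Two graphs are cospectral if their adjacency matrices have the same characteristic polynomial. *)

(* Defs.v *)
From HB Require Import structures.
From mathcomp Require Import all_boot all_order all_algebra.
From mathcomp Require Import all_classical all_reals all_analysis.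
From mathcomp Require Import complex.

Set Implicit Arguments.
Unset Strict Implicit.
Unset Printing Implicit Defensive.

Import GRing.Theory.
Import numFieldNormedType.Exports.
Local Open Scope classical_set_scope.
Local Open Scope ring_scope.

Record sgraph := SGraph {
  vertex :> finType;
  adj : rel vertex;
  adj_sym : symmetric adj;
  adj_irrefl : irreflexive adj }.

Section Induced.
Variables (X : sgraph) (S : {set X}).

Definition induced_adj : rel {x : X | x \in S} :=
  [rel x y | adj (val x) (val y)].

Lemma induced_adj_sym : symmetric induced_adj.
Proof. by move=> x y; exact: adj_sym. Qed.

Lemma induced_adj_irrefl : irreflexive induced_adj.
Proof. by move=> x; exact: adj_irrefl. Qed.

Definition induced : sgraph := SGraph induced_adj_sym induced_adj_irrefl.

End Induced.

(* Matrices indexed by the vertices are indexed by 'I_#|X|, the row and column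
   i standing for the vertex enum_val i. *)
Definition adjmx (F : pzRingType) (X : sgraph) : 'M[F]_#|X| :=
  \matrix_(i, j) (adj (enum_val i) (enum_val j))%:R.

Definition cospectral (X Y : sgraph) : Prop :=
  char_poly (adjmx int X) = char_poly (adjmx int Y).

Definition setmx (F : pzRingType) (X : sgraph) (S : {set X}) : 'M[F]_#|X| :=
  diag_mx (\row_i (enum_val i \in S)%:R).

(* The limit is taken in the library's topology on matrices, i.e. entrywise. *)
Definition expmx (K : numFieldType) (n : nat) (M : 'M[K]_n) : 'M[K]_n :=
  lim ((fun N => \sum_(k < N) (k`!%:R)^-1 *: M ^+ k) @ \oo).

Definition transition (R : realType) (X : sgraph) (t : R) : 'M[R[i]]_#|X| :=
  expmx (('i * t%:C)%C *: adjmx R[i] X).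

Definition subset_transfer (R : realType) (X : sgraph) (S T : {set X}) : Prop :=
  exists t : R,
    transition X t *m (#|S|%:R^-1 *: setmx R[i] S) *m transition X (- t)
    = #|T|%:R^-1 *: setmx R[i] T.

(* Main.v *)
From mathcomp Require Import all_boot all_order all_algebra.
From mathcomp Require Import all_classical all_reals all_analysis.
From mathcomp Require Import complex spectral.
From mathcomp Require Import finset.
Require Import Defs.

(** The adjacency matrix [A] is real symmetric, so it is diagonalizable with real
    eigenvalues [x], and [U(t)] is diagonal in the same basis with entries
    [cos (t x) + i sin (t x)]; in particular [U(-t)] is the inverse of [U(t)] and
    [U(t)] commutes with [A]. Since [D_S] and [D_T] are nonzero idempotents,
    subset transfer forces [|S| = |T|], hence [U(t) D_S U(-t) = D_T]. Conjugation
    by [U(t)] then carries [D_S A D_S] to [D_T A D_T], and likewise for the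
    complements because [D_(~S) = 1 - D_S]. Finally, the characteristic polynomial
    of [D_S A D_S] is that of the induced subgraph on [S] up to the factor
    ['X^(n - |S|)]. *)

Set Implicit Arguments.
Unset Strict Implicit.
Unset Printing Implicit Defensive.

Import Order.TTheory GRing.Theory Num.Theory.
Import numFieldNormedType.Exports.
Local Open Scope classical_set_scope.
Local Open Scope ring_scope.
Local Open Scope complex_scope.

(** * Characteristic polynomials of products and conjugates *)

(** Both sides equal ['X^n * \det L] for the block matrix [L] with rows ['X, M'] and [N', 1]: a
    unipotent factor on the right clears [N'], and a triangular factor of determinant ['X^n] on the
    left clears the same block while leaving ['X%:M - N' *m M']. *)
Lemma char_poly_mulmxC (F : comNzRingType) (m n : nat)
    (M : 'M[F]_(m, n)) (N : 'M[F]_(n, m)) :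
  'X^n * char_poly (M *m N) = 'X^m * char_poly (N *m M).
Proof.
rewrite /char_poly /char_poly_mx !map_mxM.
set M' := map_mx _ M; set N' := map_mx _ N.
pose L := block_mx 'X%:M M' N' (1%:M : 'M[{poly F}]_n).
have detL : \det L = \det ('X%:M - M' *m N').
  have <- : \det (L *m block_mx 1%:M 0 (- N') 1%:M) = \det L.
    by rewrite det_mulmx det_lblock !det1 !mulr1.
  rewrite /L mulmx_block !mulmx1 !mulmx0 mul1mx mulmxN subrr !add0r.
  by rewrite det_ublock det1 mulr1.
have : \det (block_mx 1%:M 0 (- N') 'X%:M *m L) = 'X^n * \det L.
  by rewrite det_mulmx det_lblock det1 mul1r det_scalar.
rewrite /L mulmx_block !mul1mx !mul0mx !addr0 mulNmx mul_mx_scalar.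
by rewrite mul_scalar_mx addNr det_ublock det_scalar mulmx1 mulNmx addrC -/L detL.
Qed.

Lemma char_poly_conjmx (F : comNzRingType) (n : nat) (P Q M : 'M[F]_n) :
  Q *m P = 1%:M -> char_poly (P *m M *m Q) = char_poly M.
Proof.
move=> QP1.
have lregXn : GRing.lreg ('X^n : {poly F}) by exact/monic_lreg/monicXn.
by apply: lregXn; rewrite -mulmxA char_poly_mulmxC -mulmxA QP1 mulmx1.
Qed.

(** * Induced subgraphs as compressions of the adjacency matrix *)

Section InducedSubgraph.
Variables (F : comNzRingType) (X : sgraph).
Implicit Types S T : {set X}.

(** The rows are the standard basis vectors of the vertices in [S], so [B *m B^T] is the identity
    and [B^T *m B] is the projection [setmx F S]. *)
Definition inclmx S : 'M[F]_(#|induced S|, #|X|) :=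
  \matrix_(i, j) (val (enum_val i) == enum_val j)%:R.

Lemma mul_inclmx S n (M : 'M[F]_(#|X|, n)) i j :
  (inclmx S *m M) i j = M (enum_rank (val (enum_val i))) j.
Proof.
rewrite mxE (bigD1 (enum_rank (val (enum_val i)))) //= !mxE enum_rankK eqxx mul1r.
rewrite big1 ?addr0 // => k kNi; rewrite mxE.
case: eqP => [e|]; last by rewrite mul0r.
by rewrite e enum_valK eqxx in kNi.
Qed.

Lemma mul_tr_inclmx S n (M : 'M[F]_(n, #|X|)) i j :
  (M *m (inclmx S)^T) i j = M i (enum_rank (val (enum_val j))).
Proof. by rewrite -[M *m _]trmxK trmx_mul trmxK mxE mul_inclmx mxE. Qed.

Lemma inclmx_mul_tr S : inclmx S *m (inclmx S)^T = 1%:M.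
Proof.
apply/matrixP => i j; rewrite mul_inclmx !mxE enum_rankK.
by rewrite val_eqE (inj_eq enum_val_inj) eq_sym.
Qed.

Lemma tr_inclmx_mul S : (inclmx S)^T *m inclmx S = setmx F S.
Proof.
apply/matrixP => i j; rewrite !mxE.
have [iS|iNS] := boolP (enum_val i \in S); last first.
  rewrite mul0rn big1 // => k _; rewrite !mxE.
  case: eqP => [e|]; last by rewrite mul0r.
  by move: iNS; rewrite -e (valP (enum_val k)).
pose k0 : 'I_#|induced S| := enum_rank (exist (fun x => x \in S) _ iS : induced S).
rewrite (bigD1 k0) //= !mxE enum_rankK /= eqxx mul1r (inj_eq enum_val_inj).
rewrite big1 ?addr0 // => k kN0; rewrite !mxE.
case: eqP => [e|]; last by rewrite mul0r.
have : enum_val k = exist (fun x => x \in S) _ iS by exact: val_inj.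
by move=> /(congr1 enum_rank); rewrite enum_valK => e'; rewrite e' eqxx in kN0.
Qed.

Lemma adjmx_induced S :
  adjmx F (induced S) = inclmx S *m adjmx F X *m (inclmx S)^T.
Proof.
by apply/matrixP => i j; rewrite mul_tr_inclmx mul_inclmx !mxE !enum_rankK.
Qed.

Lemma char_poly_induced S :
  'X^#|X| * char_poly (adjmx F (induced S)) =
  'X^#|S| * char_poly (setmx F S *m adjmx F X *m setmx F S).
Proof.
rewrite adjmx_induced -tr_inclmx_mul; set B := inclmx S.
(* Moving the leading [B^T] to the right end creates [B *m B^T = 1] and leaves the compression
   [B *m A *m B^T]; the powers of ['X] account for the change of size. *)
rewrite (_ : B^T *m B *m _ *m _ = B^T *m (B *m adjmx F X *m B^T *m B));
  last by rewrite !mulmxA.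
have -> : #|S| = #|induced S| by rewrite card_sig; apply: eq_card.
by rewrite [RHS]char_poly_mulmxC -[in RHS]mulmxA inclmx_mul_tr mulmx1.
Qed.

Lemma setmx_idem S : setmx F S *m setmx F S = setmx F S.
Proof.
by rewrite -tr_inclmx_mul mulmxA -[_ *m _ *m _^T]mulmxA inclmx_mul_tr mulmx1.
Qed.

Lemma setmxC S : setmx F (~: S) = 1%:M - setmx F S.
Proof.
apply/matrixP => i j; rewrite !mxE inE.
by case: (_ \in S); case: (i == j); rewrite /= ?mulr0n ?mulr1n ?subr0 ?subrr.
Qed.

End InducedSubgraph.

Lemma map_adjmx (F : pzRingType) (X : sgraph) :
  map_mx intr (adjmx int X) = adjmx F X.
Proof. by apply/matrixP => i j; rewrite !mxE mulrz_nat. Qed.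

(** The integers embed in [F], so integer polynomials may be compared there. *)
Lemma cospectral_numDomain (F : numDomainType) (X Y : sgraph) :
  char_poly (adjmx F X) = char_poly (adjmx F Y) -> cospectral X Y.
Proof.
rewrite -(map_adjmx F X) -(map_adjmx F Y) -!map_char_poly.
move=> /map_inj_poly; apply=> //.
exact: intr_inj.
Qed.

Lemma cospectral_induced_conj (F : numDomainType) (X : sgraph) (S T : {set X})
    (U V : 'M[F]_#|X|) :
    V *m U = 1%:M -> U *m adjmx F X = adjmx F X *m U -> #|S| = #|T| ->
    U *m setmx F S *m V = setmx F T ->
  cospectral (induced S) (induced T).
Proof.
move=> VU1 UA cardST US; apply: (@cospectral_numDomain F).
have lregXn : GRing.lreg ('X^#|X| : {poly F}) by exact/monic_lreg/monicXn.
apply: lregXn; rewrite /= !char_poly_induced cardST -US; congr (_ * _).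
rewrite -[LHS](char_poly_conjmx _ VU1); congr char_poly.
(* Replacing [A] by [V *m A *m U] turns the conjugate of [D_S A D_S] into
   [(U D_S V) A (U D_S V)]. *)
have VAU : V *m adjmx F X *m U = adjmx F X.
  by rewrite -mulmxA -UA mulmxA VU1 mul1mx.
by rewrite -[in LHS]VAU !mulmxA.
Qed.

(* [R[i]] has a topology only when seen as a [numFieldType]. *)
Local Notation C R := (Num.NumField.sort R[i]).

(** * Entrywise limits and the exponential series on the imaginary axis *)

Lemma cvg_mx_coord (K : numFieldType) (m n : nat) (f : nat -> 'M[K]_(m, n))
    (M : 'M[K]_(m, n)) :
  (forall i j, (fun N => f N i j) @ \oo --> M i j) -> f @ \oo --> M.
Proof.
move=> fM; apply/cvg_ballP => e e0.
have : \forall N \near \oo, forall ij : 'I_m * 'I_n,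
    ball (M ij.1 ij.2) e (f N ij.1 ij.2).
  by apply: filter_forall => -[i j]; move/cvg_ballP: (fM i j); exact.
by apply: filterS => N fN; split=> // i j; exact: (fN (i, j)).
Qed.

Lemma cvg_complex (R : realType) (f : nat -> C R) (a b : R) :
  (fun n => complex.Re (f n)) @ \oo --> a ->
  (fun n => complex.Im (f n)) @ \oo --> b ->
  f @ \oo --> (a +i* b : C R).
Proof.
move=> fa fb; apply/cvgrPdist_lt => -[e e'].
(* A positive element of [R[i]] has zero imaginary part, so the radius is real and can be halved in
   [R]. *)
rewrite ltcE /= => /andP[/eqP-> e0].
have e20 : 0 < e / 2 by rewrite divr_gt0.
move/cvgrPdist_lt: fa => /(_ _ e20) fa; move/cvgrPdist_lt: fb => /(_ _ e20) fb.
near=> n.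
have -> : a +i* b - f n =
    (a - complex.Re (f n))%:C + 'i * (b - complex.Im (f n))%:C.
  by rewrite [LHS]complexE; case: (f n).
apply: le_lt_trans (ler_normD _ _) _.
rewrite normrM [`|'i|]normc_def /= expr0n expr1n add0r sqrtr1 mul1r.
rewrite !normc_def /= expr0n !addr0 !sqrtr_sqr -rmorphD /=.
rewrite ltcR (splitr e) ltrD //.
  by near: n.
by near: n.
Unshelve. all: by end_near. Qed.

Definition cis (R : realType) (x : R) : R[i] := cos x +i* sin x.

Lemma cis_mulN (R : realType) (x : R) : cis x * cis (- x) = 1.
Proof.
rewrite /cis cosN sinN; apply/eqP; rewrite eq_complex /=.
by rewrite mulrN opprK -!expr2 cos2Dsin2 eqxx mulrN mulrC addNr eqxx.
Qed.

(** The parity factors are those of [cos_coeff] and [sin_coeff], so that the exponential series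
    splits term by term. *)
Lemma expr_i (R : realType) k : ('i : C R) ^+ k =
  ((~~ odd k)%:R * (-1) ^+ k./2) +i* ((odd k)%:R * (-1) ^+ k.-1./2).
Proof.
rewrite -[in LHS](odd_double_half k) exprD -mul2n exprM sqr_i.
have -> : (-1) ^+ k./2 = ((-1) ^+ k./2)%:C :> C R by rewrite rmorphXn rmorphN1.
case: k => [|k] /=; first by simpc.
by rewrite uphalf_half; case: (odd k); simpc.
Qed.

Lemma exp_series_cis (R : realType) (x : R) :
  (fun N => \sum_(k < N) k`!%:R^-1 * ('i * x%:C : C R) ^+ k) @ \oo -->
  (cis x : C R).
Proof.
have term k : k`!%:R^-1 * ('i * x%:C) ^+ k = cos_coeff x k +i* sin_coeff x k.
  have -> : k`!%:R^-1 = (k`!%:R^-1)%:C :> C R by rewrite fmorphV rmorph_nat.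
  rewrite exprMn -rmorphXn expr_i /cos_coeff /sin_coeff /=; simpc.
  by congr (_ +i* _); rewrite mulrC.
have sumE N : \sum_(k < N) k`!%:R^-1 * ('i * x%:C : C R) ^+ k =
    series (cos_coeff x) N +i* series (sin_coeff x) N.
  elim: N => [|N IH]; first by rewrite big_ord0 /series /= !big_geq.
  by rewrite big_ord_recr IH term /series /= !big_nat_recr.
(* Unlocking shows [cos] and [sin] as limits of these series, so only convergence remains. *)
rewrite (funext sumE); apply: cvg_complex => /=; rewrite unlock.
  exact: is_cvg_series_cos_coeff.
exact: is_cvg_series_sin_coeff.
Qed.

(** * Exponentials of diagonalizable matrices *)

Section ConjMatrix.
Variables (K : comUnitRingType) (n : nat).

Lemma mul_conjmx (P D E : 'M[K]_n) : P \in unitmx ->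
  (invmx P *m D *m P) *m (invmx P *m E *m P) = invmx P *m (D *m E) *m P.
Proof. by move=> uP; rewrite -!mulmxA (mulmxA P) mulmxV // mul1mx. Qed.

Lemma comm_conj_diag_mx (P : 'M[K]_n) (d e : 'rV[K]_n) : P \in unitmx ->
  comm_mx (invmx P *m diag_mx d *m P) (invmx P *m diag_mx e *m P).
Proof. by move=> uP; rewrite /comm_mx !mul_conjmx // diag_mxC. Qed.

Lemma expr_conjmx (P D : 'M[K]_n) k : P \in unitmx ->
  (invmx P *m D *m P) ^+ k = invmx P *m D ^+ k *m P.
Proof.
move=> uP; elim: k => [|k IH]; first by rewrite !expr0 mulmx1 mulVmx.
by rewrite !exprS IH -mulmxE mul_conjmx.
Qed.

Lemma expr_diag_mx (d : 'rV[K]_n) k :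
  diag_mx d ^+ k = diag_mx (\row_i d 0 i ^+ k).
Proof.
elim: k => [|k IH].
  by rewrite expr0; apply/matrixP => i j; rewrite !mxE expr0.
rewrite exprS IH -mulmxE mulmx_diag; congr diag_mx.
by apply/rowP => i; rewrite !mxE exprS.
Qed.

Lemma mul_diag_mx_coord (P Q : 'M[K]_n) (d : 'rV[K]_n) i j :
  (P *m diag_mx d *m Q) i j = \sum_k P i k * d 0 k * Q k j.
Proof. by rewrite mxE; apply: eq_bigr => k _; rewrite mul_mx_diag mxE. Qed.

End ConjMatrix.

Section ExpDiagonalizable.
Variables (K : numFieldType) (n : nat).

Lemma expmx_diagonalizable (P : 'M[K]_n) (d e : 'rV[K]_n) : P \in unitmx ->
    (forall k, (fun N => \sum_(m < N) m`!%:R^-1 * d 0 k ^+ m) @ \oo --> e 0 k) ->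
  expmx (invmx P *m diag_mx d *m P) = invmx P *m diag_mx e *m P.
Proof.
move=> uP de; rewrite /expmx; apply: cvg_lim; first exact: norm_hausdorff.
apply: cvg_mx_coord => i j; rewrite mul_diag_mx_coord.
(* Each entry of a partial sum is a fixed finite linear combination of the scalar partial sums at
   the eigenvalues. *)
rewrite (_ : (fun N => _) = fun N => \sum_k invmx P i k *
    (\sum_(m < N) m`!%:R^-1 * d 0 k ^+ m) * P k j); last first.
  apply/funext => N; rewrite summxE.
  under [RHS]eq_bigr do rewrite mulr_sumr mulr_suml.
  rewrite exchange_big /=; apply: eq_bigr => m _.
  rewrite mxE expr_conjmx // expr_diag_mx mul_diag_mx_coord mulr_sumr.
  by apply: eq_bigr => k _; rewrite mxE !mulrA (mulrC (invmx P i k)).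
apply: cvg_big => [|k _]; first exact: add_continuous.
by apply: cvgMl; apply: cvgMr; exact: de.
Qed.

End ExpDiagonalizable.

(** * Spectral form of the transition matrix *)

Lemma adjmx_spectral (R : realType) (X : sgraph) :
  exists P : 'M[R[i]]_#|X|, exists x : 'I_#|X| -> R,
  P \in unitmx /\ adjmx R[i] X = invmx P *m diag_mx (\row_i (x i)%:C) *m P.
Proof.
have herm : adjmx R[i] X \is hermsymmx.
  apply: realsym_hermsym; last by apply/mxOverP => i j; rewrite mxE realn.
  apply/is_hermitianmxP/matrixP => i j.
  by rewrite !mxE expr0 mul1r adj_sym.
exists (spectralmx (adjmx R[i] X)).
(* Hermitian matrices have real eigenvalues, so taking real parts changes nothing. *)
exists (fun i => complex.Re (spectral_diag (adjmx R[i] X) 0 i)).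
split; first exact: spectral_unit.
rewrite (_ : \row_i _ = spectral_diag (adjmx R[i] X)).
  exact/orthomx_spectralP/hermitian_normalmx.
apply/rowP => i; rewrite mxE RRe_real //.
by move/mxOverP: (hermitian_spectral_diag_real herm); exact.
Qed.

Lemma transition_spectral (R : realType) (X : sgraph) (P : 'M[R[i]]_#|X|)
    (x : 'I_#|X| -> R) (t : R) : P \in unitmx ->
    adjmx R[i] X = invmx P *m diag_mx (\row_i (x i)%:C) *m P ->
  transition X t = invmx P *m diag_mx (\row_i cis (t * x i)) *m P.
Proof.
move=> uP AE; rewrite /transition AE scalemxAl scalemxAr -linearZ /=.
apply: expmx_diagonalizable => // k; rewrite !mxE -mulrA -rmorphM.
exact: exp_series_cis.
Qed.

Lemma transition_comm (R : realType) (X : sgraph) (t : R) :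
  transition X t *m adjmx R[i] X = adjmx R[i] X *m transition X t.
Proof.
have [P [x [uP AE]]] := adjmx_spectral R X.
rewrite (transition_spectral t uP AE) AE.
exact: (comm_conj_diag_mx _ _ uP).
Qed.

Lemma transition_mulN (R : realType) (X : sgraph) (t : R) :
  transition X (- t) *m transition X t = 1%:M.
Proof.
have [P [x [uP AE]]] := adjmx_spectral R X.
rewrite !(transition_spectral _ uP AE).
rewrite (mul_conjmx _ _ uP) mulmx_diag.
rewrite (_ : \row_i ((\row_j _) 0 i * _) = const_mx 1).
  by rewrite diag_const_mx mulmx1 mulVmx.
by apply/rowP => i; rewrite !mxE mulNr mulrC cis_mulN.
Qed.

(** * Equal sizes and the transfer theorem *)

Lemma setmx_neq0 (F : comNzRingType) (X : sgraph) (S : {set X}) :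
  S != set0 -> setmx F S != 0.
Proof.
move=> /set0Pn[x xS]; apply/eqP => /matrixP/(_ (enum_rank x) (enum_rank x)).
by rewrite !mxE eqxx enum_rankK xS mulr1n => /eqP; rewrite oner_eq0.
Qed.

(** A conjugate of an idempotent is idempotent, so [c ^+ 2 = c] because [D_T] is nonzero. Comparing
    traces would only give [|S| = c |T|], which holds automatically for the ratio of sizes. *)
Lemma conj_setmx_scale_eq1 (F : fieldType) (X : sgraph) (S T : {set X})
    (U V : 'M[F]_#|X|) (c : F) : T != set0 -> V *m U = 1%:M -> c != 0 ->
  U *m setmx F S *m V = c *: setmx F T -> c = 1.
Proof.
move=> T0 VU1 c0 US.
have : (U *m setmx F S *m V) *m (U *m setmx F S *m V) = U *m setmx F S *m V.
  rewrite !mulmxA -(mulmxA _ V U) VU1 mulmx1 -(mulmxA U (setmx F S)).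
  by rewrite setmx_idem.
rewrite US -scalemxAl -scalemxAr setmx_idem scalerA => /eqP.
rewrite -subr_eq0 -scalerBl scaler_eq0 (negPf (setmx_neq0 _ T0)) orbF.
by rewrite subr_eq0 -[X in _ == X]mulr1 => /eqP/(mulfI c0).
Qed.

Theorem theorem6p4 (R : realType) (X : sgraph) (S T : {set X})
    (S0 : S != set0) (T0 : T != set0) (tr : subset_transfer R S T) :
  cospectral (induced S) (induced T) /\
  cospectral (induced (~: S)) (induced (~: T)).
Proof.
have [t US] := tr.
have VU1 := transition_mulN X t; have UA := transition_comm X t.
move: (transition X t) (transition X (- t)) VU1 UA US => U V VU1 UA US.
have S_neq0 : #|S|%:R != 0 :> R[i] by rewrite pnatr_eq0 cards_eq0.
have T_neq0 : #|T|%:R != 0 :> R[i] by rewrite pnatr_eq0 cards_eq0.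
have {}US : U *m setmx R[i] S *m V = (#|S|%:R / #|T|%:R) *: setmx R[i] T.
  by rewrite -scalerA -US -scalemxAr -scalemxAl scalerA divff // scale1r.
have c1 : #|S|%:R / #|T|%:R = 1 :> R[i].
  by apply: (conj_setmx_scale_eq1 T0 VU1 _ US); rewrite mulf_neq0 ?invr_eq0.
have cardST : #|S| = #|T|.
  by apply/eqP; rewrite -(eqr_nat R[i]) -(divfK T_neq0 #|S|%:R) c1 mul1r.
rewrite c1 scale1r in US.
split; first exact: (cospectral_induced_conj VU1 UA cardST US).
apply: (cospectral_induced_conj VU1 UA).
  by rewrite (cardsCs (~: S)) (cardsCs (~: T)) !setCK cardST.
(* For square matrices [V *m U = 1] gives [U *m V = 1], hence [U (1 - D_S) V = 1 - D_T]. *)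
by rewrite !setmxC mulmxBr mulmxBl US mulmx1 (mulmx1C VU1).
Qed.
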